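(* Let $k\ge2$ and let $H_2$ be a $k$-minimal graph (with vertex set $[3]^k$). Then $|E(H_2)|=\frac{3^k+1}{2}$ if and only if $H_2=\mathbb T_k$.
   Context: All graphs are finite and simple. $[k]=\{1,\dots,k\}$; $[3]^k$ is the set of vectors $x=(x_{(1)},\dots,x_{(k)})$ with entries in $\{1,2,3\}$. For a graph $F$ and $S\subseteq V(F)$, $\mathcal E(F,S)$ is the set of all $S$-coverings in $F$, i.e. sets $E\subseteq E(F)$ such that every vertex of $S$ is incident to at least one edge of $E$. $\overline K_{[k]}$ is the edgeless graph on $[k]$. For a graph $H_2$ on $[3]^k$, $\overline K_{[k]}\circ H_2$ is the graph on the disjoint union $[k]\sqcup[3]^k$ with edge set $E(H_2)\cup\{\{i,x\}: i\in[k],\ x\in[3]^k,\ x_{(i)}=1\}$. For a set $E$ of 2-subsets of $[3]^k$, $span(E)$ is the graph with vertex set $[3]^k$ and edge set $E$. For $i\in[k]$ and $j\in\{1,2,3\}$ let $[3]^k_i(j)=\{x\in[3]^k:x_{(i)}=j\}$. Let $C^k_i$ be the bipartite graph with parts $[3]^k_i(1)$ and $[3]^k_i(2)$, in which $x\in[3]^k_i(1)$ and $y\in[3]^k_i(2)$ are adjacent iff $|x_{(t)}-y_{(t)}|\le1$ for all $t\in[k]\setminus\{i\}$; let $D^k_i$ be the bipartite graph with parts $[3]^k_i(2)$ and $[3]^k_i(3)$, in which $x\in[3]^k_i(2)$ and $y\in[3]^k_i(3)$ are adjacent iff $|x_{(t)}-y_{(t)}|\le1$ for all $t\in[k]\setminus\{i\}$.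 Let $S^k_i=\{x\in[3]^k: x_{(i)}=3,\ x_{(t)}\in\{2,3\}\ \forall t\in[k]\}$. Define $$\mathcal C_k=\Big\{\overline K_{[k]}\circ span\Big(\bigcup_{i\in[k]}(E_i\cup F_i)\Big): E_i\in\mathcal E(C^k_i,[3]^k_i(2)),\ F_i\in\mathcal E(D^k_i,S^k_i)\ \text{for each } i\in[k]\Big\}.$$ $H_2$ is called $k$-minimal if $\overline K_{[k]}\circ H_2\in\mathcal C_k$ and $\overline K_{[k]}\circ H_2'\notin\mathcal C_k$ for every spanning subgraph $H_2'\ne H_2$ of $H_2$. The graph $\mathbb T_k$: let $X=\{2,3\}^k\subseteq[3]^k$, $Y=\{1,3\}^k\subseteq[3]^k$ and $Z=[3]^k\setminus(X\cup Y)$. $\mathbb T_k$ has vertex set $[3]^k$ and edge set $E_X\cup E_Z$, where $E_X=\{\{x,y\}: x\in X,\ y\in[3]^k,\ x_{(i)}-y_{(i)}=1\text{ for each }i\in[k]\}$ and $E_Z=\{\{x,y\}: x,y\in Z,\ \text{for each } i\in[k]\text{ either }x_{(i)}=y_{(i)}=3\text{ or }\{x_{(i)},y_{(i)}\}=\{1,2\}\}$. *)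

(* Defs.v *)
From mathcomp Require Import all_boot ssrint.
Set Implicit Arguments.
Unset Strict Implicit.
Unset Printing Implicit Defensive.

(* The vertex set is part of the type, so a spanning subgraph of a graph is a
   graph of the same type with fewer edges, and [=] is equality of edge sets
   (lemma [sgraph_eqP]). *)
Record sgraph (T : finType) (V : {set T}) := SGraph {
  edges : {set {set T}};
  edgesP : [forall e in edges, (#|e| == 2) && (e \subset V)]
}.

Lemma sgraph_eqP (T : finType) (V : {set T}) (G H : sgraph V) :
  G = H <-> edges G = edges H.
Proof.
split=> [-> //|]; case: G H => [E EP] [F FP] /= eqEF.
by case: F / eqEF FP => FP; rewrite (bool_irrelevance EP FP).
Qed.

Definition spanning_subgraph (T : finType) (V : {set T}) (G H : sgraph V) :=
  edges G \subset edges H.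

Definition coverings (T : finType) (V : {set T}) (G : sgraph V) (S : {set T}) :
    {set {set {set T}}} :=
  [set E : {set {set T}} | (E \subset edges G)
     && [forall v in S, [exists e in E, v \in e]]].

(* [3]^k : the element j of {1, 2, 3} is encoded by j - 1 in 'I_3, and every
   definition below goes through [coord], which returns j itself. *)
Definition cube (k : nat) : finType := {ffun 'I_k -> 'I_3}.

Definition coord (k : nat) (x : cube k) (i : 'I_k) : nat := (x i).+1.

Definition slab (k : nat) (i : 'I_k) (j : nat) : {set cube k} :=
  [set x | coord x i == j].

(* Elements of E that are not 2-subsets are dropped. *)
Fact span_subproof (k : nat) (E : {set {set cube k}}) :
  [forall e in [set e in E | #|e| == 2],
     (#|e| == 2) && (e \subset [set: cube k])].
Proof.
by apply/forall_inP=> e; rewrite inE => /andP[_ ->]; rewrite subsetT.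
Qed.

Definition span (k : nat) (E : {set {set cube k}}) : sgraph [set: cube k] :=
  SGraph (span_subproof E).

(* [inl] embeds the vertices of the edgeless graph on [k], [inr] those of H. *)
Definition compose_edges (k : nat) (H : sgraph [set: cube k]) :
    {set {set 'I_k + cube k}} :=
  [set [set inr x | x in e] | e : {set cube k} in edges H]
  :|: [set [set inl i; inr x] | i in 'I_k, x in slab i 1].

Fact compose_subproof (k : nat) (H : sgraph [set: cube k]) :
  [forall e in compose_edges H,
     (#|e| == 2) && (e \subset [set: 'I_k + cube k])].
Proof.
apply/forall_inP=> e; rewrite subsetT andbT => /setUP[].
  case/imsetP=> f fH ->; rewrite card_imset; last by move=> x y [].
  by have /forall_inP/(_ f fH)/andP[] := edgesP H.
by case/imset2P=> i x _ _ ->; rewrite cards2.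
Qed.

Definition compose (k : nat) (H : sgraph [set: cube k]) :
    sgraph [set: 'I_k + cube k] :=
  SGraph (compose_subproof H).

Definition layer_edges (k : nat) (i : 'I_k) (j j' : nat) : {set {set cube k}} :=
  [set [set x; y] | x in slab i j, y in slab i j'
     & [forall (t | t != i), `|coord x t - coord y t|%N <= 1]].

Fact layer_subproof (k : nat) (i : 'I_k) (j j' : nat) : j != j' ->
  [forall e in layer_edges i j j',
     (#|e| == 2) && (e \subset slab i j :|: slab i j')].
Proof.
move=> neq; apply/forall_inP=> e /imset2P[x y xj]; rewrite inE => /andP[yj' _] ->.
rewrite cards2 subUset !sub1set !inE; move: xj yj'; rewrite !inE => xj yj'.
rewrite xj yj' orbT /= andbT; case: (x =P y) => // eqxy.
by move: neq; rewrite -(eqP xj) -(eqP yj') eqxy eqxx.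
Qed.

Definition graphC (k : nat) (i : 'I_k) : sgraph (slab i 1 :|: slab i 2) :=
  SGraph (layer_subproof i (isT : 1 != 2)).

Definition graphD (k : nat) (i : 'I_k) : sgraph (slab i 2 :|: slab i 3) :=
  SGraph (layer_subproof i (isT : 2 != 3)).

Definition setS (k : nat) (i : 'I_k) : {set cube k} :=
  [set x | (coord x i == 3) && [forall t, coord x t \in [:: 2; 3]]].

Definition classC (k : nat) (G : sgraph [set: 'I_k + cube k]) : Prop :=
  exists E F : 'I_k -> {set {set cube k}},
    [/\ forall i, E i \in coverings (graphC i) (slab i 2),
        forall i, F i \in coverings (graphD i) (setS i)
      & G = compose (span (\bigcup_i (E i :|: F i)))].

Definition kminimal (k : nat) (H : sgraph [set: cube k]) : Prop :=
  classC (compose H) /\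
  (forall H' : sgraph [set: cube k],
     spanning_subgraph H' H -> H' <> H -> ~ classC (compose H')).

Definition setX (k : nat) : {set cube k} :=
  [set x | [forall i, coord x i \in [:: 2; 3]]].

Definition setY (k : nat) : {set cube k} :=
  [set x | [forall i, coord x i \in [:: 1; 3]]].

Definition setZ (k : nat) : {set cube k} := ~: (setX k :|: setY k).

Definition edgesX (k : nat) : {set {set cube k}} :=
  [set [set x; y] | x in setX k, y in [set: cube k]
     & [forall i, coord x i == (coord y i).+1]].

Definition edgesZ (k : nat) : {set {set cube k}} :=
  [set [set x; y] | x in setZ k, y in setZ k
     & [forall i, [|| (coord x i == 3) && (coord y i == 3),
                      (coord x i == 1) && (coord y i == 2)
                    | (coord x i == 2) && (coord y i == 1)]]].

Definition graphT (k : nat) : sgraph [set: cube k] :=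
  span (edgesX k :|: edgesZ k).

(* [span] drops nothing here, except for the degenerate k = 0. *)
Lemma edges_graphT (k : nat) :
  0 < k -> edges (graphT k) = edgesX k :|: edgesZ k.
Proof.
case: k => // k _; apply/setP=> e; rewrite inE andb_idr // => /setUP[].
  case/imset2P=> x y _; rewrite !inE => /forallP/(_ ord0) xy ->.
  by rewrite cards2; case: (x =P y) xy => // -> /eqP/n_Sn.
case/imset2P=> x y xZ; rewrite !inE => /andP[_ /forallP xy] ->.
rewrite cards2; case: (x =P y) => // eqxy; move: xZ; rewrite !inE negb_or.
case/andP=> /forallP[] i; move: (xy i); rewrite -eqxy !inE.
by case: (coord x i) => [|[|[|[]]]].
Qed.

(* Main.v *)
(* Membership in C_k turns into a local condition: edges join points at
   sup-distance 1, and for every v and i with v_i = 2 (or v_i = 3, if v is in X)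
   some neighbour u of v has u_i = v_i - 1; such a u "helps" v.  Give each edge
   charge 2, sent to its helped endpoint, or 1 to each if they help each other.
   Every vertex of Z is helped, hence receives at least 1.  Every vertex v of X
   receives 2 along a single edge: if v_i = 2, a helper with i-th coordinate 1
   is outside X and so is not helped by v, while the all-3 vector helps nobody.
   Thus 2|E| >= 2|X| + |Z| = 3^k + 1.  In case of equality each vertex v of X
   has a single helper, which must be v - (1,...,1), and the vertices of Z are
   matched in pairs of mutual helpers; counting coordinatewise, a vertex of Z is
   matched with the one obtained by exchanging 1 and 2. *)

From mathcomp Require Import all_boot perm ssrint zify.
(* Imported last, so that [setX] is not the cartesian product of finset. *)
Require Import Defs.

Set Implicit Arguments.
Unset Strict Implicit.
Unset Printing Implicit Defensive.

(** * Double counting of edges by weights on ordered pairs *)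

Section OrderedPairs.
Variables (T : finType) (E : {set {set T}}) (w : T -> T -> nat).

Lemma sum_pairs_of_set2 (a b : T) : a != b ->
  \sum_(p : T * T | [set p.1; p.2] == [set a; b]) w p.1 p.2 = w a b + w b a.
Proof.
move=> neq_ab; rewrite (bigD1 (a, b)) //= (bigD1 (b, a)) /=; last first.
  by rewrite setUC eqxx xpair_eqE negb_and eq_sym neq_ab.
rewrite big1 ?addn0 // => -[x y] /= /andP[/andP[/eqP/setP eq_e]].
rewrite !xpair_eqE.
have := eq_e x; have := eq_e y; have := eq_e a; have := eq_e b.
rewrite !inE !eqxx !(eq_sym a) !(eq_sym b) ?orbT /=.
by do 4 case: eqP => [?|?] //; subst; rewrite ?eqxx in neq_ab *.
Qed.

Hypothesis card_edge : forall e, e \in E -> #|e| = 2.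
Hypothesis w_edge : forall u v, 0 < w u v -> [set u; v] \in E.
Hypothesis w_le2 : forall u v, u != v -> w u v + w v u <= 2.

(** Ordered pairs are grouped by the edge they span; pairs spanning no edge have weight 0, and each
    edge carries at most 2. *)
Lemma sum_pairs_leqif :
  \sum_v \sum_u w u v <= 2 * #|E|
     ?= iff [forall e in E, \sum_(p : T * T | [set p.1; p.2] == e) w p.1 p.2 == 2].
Proof.
rewrite exchange_big pair_bigA /=.
rewrite (bigID (fun p : T * T => [set p.1; p.2] \in E)) /=.
rewrite [X in _ + X]big1 ?addn0; last first.
  by move=> p; apply: contraNeq; rewrite -lt0n; apply: w_edge.
rewrite (partition_big (fun p : T * T => [set p.1; p.2]) (mem E)) //=.
rewrite mulnC -sum_nat_const; apply: leqif_sum => e eE.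
rewrite (eq_bigl (fun p => [set p.1; p.2] == e)); last first.
  by move=> p /=; case: eqP => [->|_]; rewrite ?eE ?andbF.
split=> //; move/eqP/cards2P: (card_edge eE) => [a [b [neq_ab ->]]].
by rewrite sum_pairs_of_set2 ?w_le2.
Qed.

End OrderedPairs.

(** * Coordinates in the cube and the sizes of X, Y and Z *)

Section Cube.
Variable k : nat.
Implicit Types (u v x y z : cube k) (i : 'I_k) (E : {set {set cube k}}).

Lemma coord_gt0 v i : 0 < coord v i. Proof. by []. Qed.
Lemma coord_le3 v i : coord v i <= 3. Proof. exact: ltn_ord. Qed.

Lemma cubeP u v : (forall i, coord u i = coord v i) -> u = v.
Proof. by move=> eq_uv; apply/ffunP=> i; apply/val_inj/eq_add_S/eq_uv. Qed.

Lemma setXP v : reflect (forall i, 1 < coord v i) (v \in setX k).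
Proof.
rewrite inE; apply: (iffP forallP) => vX i; move: (vX i); rewrite !inE.
  by case/orP=> /eqP->.
by have := coord_le3 v i; lia.
Qed.

Lemma setYP v : reflect (forall i, coord v i != 2) (v \in setY k).
Proof.
rewrite inE; apply: (iffP forallP) => vX i; move: (vX i); rewrite !inE.
  by case/orP=> /eqP->.
by have := coord_le3 v i; have := coord_gt0 v i; lia.
Qed.

Lemma setZP v :
  reflect ((exists i, coord v i = 1) /\ (exists i, coord v i = 2)) (v \in setZ k).
Proof.
rewrite in_setC in_setU negb_or; apply: (iffP andP) => -[].
  move=> nX nY; split.
    have /existsP[i /eqP] : [exists i, coord v i == 1]; last by exists i.
    apply: contraR nX => /existsPn nv; apply/setXP=> i.
    by have := nv i; have := coord_gt0 v i; lia.
  have /existsP[i /eqP] : [exists i, coord v i == 2]; last by exists i.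
  by apply: contraR nY => /existsPn nv; apply/setYP.
move=> [i vi] [j vj]; split; first by apply/setXP=> /(_ i); rewrite vi.
by apply/setYP=> /(_ j); rewrite vj.
Qed.

Lemma setZ_notX v : v \in setZ k -> (v \in setX k) = false.
Proof. by rewrite in_setC in_setU; case: (v \in _). Qed.

(** Coordinates are stored minus one, so transposing 0 and 1 exchanges the values 1 and 2. *)
Definition swap z : cube k := [ffun i => tperm ord0 (inord 1) (z i)].

Lemma coord_swap z i :
  coord (swap z) i = if coord z i == 1 then 2 else if coord z i == 2 then 1 else 3.
Proof.
rewrite /coord ffunE; case: tpermP => [->|->|n0 n1]; rewrite ?inordK //.
have := coord_le3 z i; rewrite /coord => z3.
have z0 : z i != 0 :> nat by apply: contra_notN n0 => /eqP zi; apply: val_inj.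
have z1 : z i != 1 :> nat.
  by apply: contra_notN n1 => /eqP zi; apply: val_inj; rewrite /= inordK.
by rewrite !eqSS (negbTE z0) (negbTE z1); lia.
Qed.

Lemma swapK : involutive swap.
Proof. by move=> z; apply/ffunP=> i; rewrite !ffunE tpermK. Qed.

Lemma swap_Z z : (swap z \in setZ k) = (z \in setZ k).
Proof.
have sub w : w \in setZ k -> swap w \in setZ k.
  case/setZP=> -[i wi] [j wj]; apply/setZP; split.
    by exists j; rewrite coord_swap wj.
  by exists i; rewrite coord_swap wi.
by apply/idP/idP=> [/sub|/sub //]; rewrite swapK.
Qed.

Lemma card_coord_pred (P : pred nat) :
  #|[set v : cube k | [forall i, P (coord v i)]]| = #|[set c : 'I_3 | P c.+1]| ^ k.
Proof.
rewrite -[X in _ ^ X]card_ord -card_ffun_on; apply: eq_card => v.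
rewrite inE; apply/forallP/ffun_onP => vP i; move: (vP i); by rewrite inE.
Qed.

Lemma card_ord3_pred (P : pred nat) :
  #|[set c : 'I_3 | P c.+1]| = P 1 + P 2 + P 3.
Proof.
rewrite cardsE -sum1_card big_mkcond /= !big_ord_recl big_ord0 /= addn0 addnA.
by rewrite -!topredE /=; do 3 case: (P _).
Qed.

Lemma card_setX : #|setX k| = 2 ^ k.
Proof. by rewrite card_coord_pred card_ord3_pred. Qed.

Lemma card_setY : #|setY k| = 2 ^ k.
Proof. by rewrite card_coord_pred card_ord3_pred. Qed.

Lemma card_setXIY : #|setX k :&: setY k| = 1.
Proof.
have -> : setX k :&: setY k = [set v : cube k | [forall i, pred1 3 (coord v i)]].
  apply/setP=> v; rewrite in_setI [RHS]inE.
  apply/andP/forallP => [[/setXP vX /setYP vY] i | v3].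
    by have := vX i; have := vY i; have := coord_le3 v i => /=; lia.
  by split; [apply/setXP|apply/setYP] => i; have := v3 i => /= /eqP->.
by rewrite card_coord_pred card_ord3_pred exp1n.
Qed.

(** X and Y have [2 ^ k] elements each and share only the all-3 vector. *)
Lemma card_setXZ : 2 * #|setX k| + #|setZ k| = 3 ^ k + 1.
Proof.
have cardT : #|cube k| = 3 ^ k by rewrite card_ffun !card_ord.
have := cardsC (setX k :|: setY k); rewrite cardT -/(setZ k).
have := subset_leq_card (subsetIl (setX k) (setY k)).
by rewrite cardsU card_setX card_setY card_setXIY; lia.
Qed.


(** * Helpers and the local form of the covering condition *)

Definition needs v i := (coord v i == 2) || (v \in setX k) && (coord v i == 3).

Definition helps u v := [exists i, needs v i && (coord v i == (coord u i).+1)].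

Lemma helps_X_inv u v : u \in setX k -> helps u v -> v \in setX k.
Proof.
move=> /setXP uX /existsP[i /andP[/orP[/eqP vi|/andP[//]]]].
by have := uX i; rewrite vi; lia.
Qed.

Lemma helps_XZ u v : helps u v -> (v \in setX k) || (v \in setZ k).
Proof.
case/existsP=> i /andP[/orP[/eqP vi|/andP[-> //]] _].
rewrite in_setC in_setU negb_or; case: (v \in setX k) => //=.
by apply/setYP=> /(_ i); rewrite vi.
Qed.

(** Edges are king moves: the second clause, read for both orders of the endpoints, bounds
    coordinate differences by 1. The third clause merges the demands of all the coverings. *)
Definition king_covering E :=
  [/\ forall e, e \in E -> #|e| = 2,
      forall u v, [set u; v] \in E -> forall i, coord u i <= (coord v i).+1
    & forall v i, needs v i ->
        exists2 u, [set u; v] \in E & coord v i = (coord u i).+1].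

(** * Discharging and the lower bound on the number of edges *)

Section KingCovering.
Variable E : {set {set cube k}}.
Hypothesis E_king : king_covering E.

Definition dart u v := ([set u; v] \in E) && helps u v.
(** A one-way dart carries 2, and each of two opposite darts carries 1. *)
Definition charge u v := dart u v * (2 - dart v u).

Lemma needs_dart v i : needs v i -> exists2 u, dart u v & coord v i = (coord u i).+1.
Proof.
move=> vi; have [_ _ /(_ v i vi)[u uv eq_v]] := E_king; exists u => //.
by rewrite /dart uv; apply/existsP; exists i; rewrite vi eq_v eqxx.
Qed.

Lemma charge_gt0 u v : (0 < charge u v) = dart u v.
Proof. by rewrite /charge; do 2 case: dart. Qed.

Lemma charge_sym_le2 u v : charge u v + charge v u <= 2.
Proof. by rewrite /charge; do 2 case: dart. Qed.

Lemma sum_charge_leqif :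
  \sum_v \sum_u charge u v <= 2 * #|E|
    ?= iff [forall e in E,
              \sum_(p : cube k * cube k | [set p.1; p.2] == e) charge p.1 p.2 == 2].
Proof.
have [card_E _ _] := E_king; apply: sum_pairs_leqif => //= u v.
  by rewrite charge_gt0 => /andP[].
by rewrite charge_sym_le2.
Qed.

Lemma charge_X v : 0 < k -> v \in setX k -> exists u, charge u v = 2.
Proof.
move=> k_gt0 vX.
suff [u uv nvu] : exists2 u, dart u v & ~~ dart v u.
  by exists u; rewrite /charge uv (negbTE nvu).
have [/existsP[i vi]|/existsPn v_n2] := boolP [exists i, coord v i == 2].
  have vN : needs v i by rewrite /needs vi.
  have [u uv ui] := needs_dart vN; exists u => //.
  (* A reverse dart would put [u] in X, but [u] has i-th coordinate 1. *)
  by apply/negP=> /andP[_ /(helps_X_inv vX) /setXP/(_ i)]; lia.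
have v3 i : coord v i = 3.
  by have := v_n2 i; have /setXP/(_ i) := vX; have := coord_le3 v i; lia.
have vN : needs v (Ordinal k_gt0) by rewrite /needs vX v3 orbT.
have [u uv _] := needs_dart vN; exists u => //.
(* Being helped by the all-3 vector would require a coordinate 4. *)
apply/negP=> /andP[_ /existsP[i /andP[_]]].
by rewrite v3; have := coord_le3 u i; lia.
Qed.

Lemma dart_Z v : v \in setZ k -> exists u, dart u v.
Proof.
case/setZP=> _ [i vi]; have vN : needs v i by rewrite /needs vi.
by have [u uv _] := needs_dart vN; exists u.
Qed.

(** The guaranteed charge; vertices of Y outside X are promised none. *)
Definition demand v := 2 * (v \in setX k) + (v \in setZ k).

Lemma sum_demand : \sum_v demand v = 3 ^ k + 1.
Proof.
rewrite -card_setXZ big_split -big_distrr /=.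
by congr (_ * _ + _); rewrite -sum1_card [RHS]big_mkcond; apply: eq_bigr => v _; case: ifP.
Qed.

Lemma demand_le v : 0 < k -> demand v <= \sum_u charge u v.
Proof.
move=> k_gt0; rewrite /demand; have [vX|vNX] := boolP (v \in setX k).
  have -> : v \in setZ k = false by rewrite in_setC in_setU vX.
  by have [u uv] := charge_X k_gt0 vX; rewrite (bigD1 u) //= uv; lia.
have [vZ|//] := boolP (v \in setZ k).
have [u uv] := dart_Z vZ; rewrite (bigD1 u) //=.
by move: uv; rewrite -charge_gt0; lia.
Qed.

Lemma sum_demand_le : 0 < k -> 3 ^ k + 1 <= 2 * #|E|.
Proof.
move=> k_gt0; rewrite -sum_demand; have [le_E _] := sum_charge_leqif.
by apply: leq_trans le_E; apply: leq_sum => v _; apply: demand_le.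
Qed.

(** * Rigidity when the lower bound is attained *)

Section Extremal.
Hypotheses (k_gt0 : 0 < k) (card_E : 2 * #|E| = 3 ^ k + 1).

(** The total charge lies between the total demand and 2|E|, which agree, so no vertex exceeds its
    demand. *)
Lemma demand_eq v : \sum_u charge u v = demand v.
Proof.
have le_d w : true -> demand w <= \sum_u charge u w ?= iff (demand w == \sum_u charge u w).
  by split=> //; apply: demand_le.
have [_ /esym] := leqif_sum le_d.
have [le_E _] := sum_charge_leqif; rewrite sum_demand.
have -> : 3 ^ k + 1 == \sum_v \sum_u charge u v.
  rewrite eqn_leq -{2}card_E le_E -sum_demand andbT.
  by apply: leq_sum => w _; apply: demand_le.
by move/forall_inP/(_ v isT)/eqP.
Qed.

(** Equality gives each edge charge exactly 2, so at least one of its orientations is a dart. *)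
Lemma edge_dart e : e \in E -> exists u v, dart u v /\ e = [set u; v].
Proof.
move=> eE; have [cardE _ _] := E_king; have [_ /esym] := sum_charge_leqif.
rewrite (eq_bigr demand) => [|v _]; last exact: demand_eq.
rewrite sum_demand card_E eqxx => /forall_inP/(_ e eE).
move/eqP/cards2P: (cardE e eE) => [a [b [neq_ab ->]]].
rewrite sum_pairs_of_set2 //= => /eqP ab.
have : (0 < charge a b) || (0 < charge b a) by lia.
by rewrite !charge_gt0 => /orP[]; [exists a, b | exists b, a; rewrite setUC].
Qed.

Lemma charge_unique u u' v : demand v <= charge u v -> dart u' v -> u' = u.
Proof.
rewrite -demand_eq (bigD1 u) //= => le_u; rewrite -charge_gt0; apply: contraTeq.
by move=> neq_u; move: le_u; rewrite (bigD1 u') //=; lia.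
Qed.

(** Every coordinate of a vertex of X needs help, and its only helper must serve them all. *)
Lemma dart_X u v : v \in setX k -> dart u v -> forall i, coord v i = (coord u i).+1.
Proof.
move=> vX uv i; have [w wv] := charge_X k_gt0 vX.
have d_v : demand v <= charge w v.
  by rewrite /demand vX in_setC in_setU vX wv.
have vN : needs v i.
  rewrite /needs vX; have /setXP/(_ i) := vX; have := coord_le3 v i; lia.
have [u' u'v ->] := needs_dart vN.
by rewrite (charge_unique d_v u'v) (charge_unique d_v uv).
Qed.

Lemma demand_Z v : v \in setZ k -> demand v = 1.
Proof. by move=> vZ; rewrite /demand vZ setZ_notX. Qed.

Lemma dart_Z_unique u u' v : v \in setZ k -> dart u v -> dart u' v -> u' = u.
Proof.
by move=> vZ uv; apply: charge_unique; rewrite demand_Z // charge_gt0.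
Qed.

(** A one-way dart would bring 2 to [v], whose demand is 1. If [u] were in X, helping [v] would put
    [v] in X. *)
Lemma dart_Z_sym u v : v \in setZ k -> dart u v -> u \in setZ k /\ dart v u.
Proof.
move=> vZ uv; have vu : dart v u.
  have := demand_eq v; rewrite demand_Z // (bigD1 u) //=.
  by rewrite /charge uv; case: (dart v u) => //; lia.
split=> //; case/andP: (vu) => _ /helps_XZ/orP[uX|//].
by have /andP[_ /(helps_X_inv uX)] := uv; rewrite setZ_notX.
Qed.

(* Taking partners injects the vertices of Z with i-th coordinate 2 into those
   with i-th coordinate 1; exchanging 1 and 2 shows that these sets have the
   same size, so the injection is onto. *)
Lemma dart_Z_coord1 u v i : v \in setZ k -> dart u v -> coord v i = 1 -> coord u i = 2.
Proof.
move=> vZ uv vi.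
(* The default [w] never occurs on Z, where every vertex has an incoming dart. *)
pose partner w := odflt w [pick x | dart x w].
have partnerP x w : w \in setZ k -> dart x w -> partner w = x.
  move=> wZ xw; rewrite /partner; case: pickP => [y yw|/(_ x)]; last by rewrite xw.
  exact: dart_Z_unique wZ xw yw.
pose A := [set w in setZ k | coord w i == 2]; pose B := [set w in setZ k | coord w i == 1].
have partnerK : {in setZ k, cancel partner partner}.
  move=> w wZ; have [x xw] := dart_Z wZ; have [xZ wx] := dart_Z_sym wZ xw.
  by rewrite (partnerP _ _ wZ xw) (partnerP _ _ xZ wx).
have sAZ : {subset A <= setZ k} by move=> w; rewrite inE => /andP[].
have imA : partner @: A \subset B.
  apply/subsetP=> _ /imsetP[w wA ->]; have wZ := sAZ w wA.
  move: wA; rewrite [_ \in A]in_set [_ \in B]in_set => /andP[_ /eqP wi].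
  have [x xw] : exists2 x, dart x w & coord w i = (coord x i).+1.
    by apply: needs_dart; rewrite /needs wi.
  rewrite wi (partnerP _ _ wZ xw) => /eq_add_S <-; rewrite eqxx andbT.
  by case: (dart_Z_sym wZ xw).
have eq_B : partner @: A = B.
  apply/eqP; rewrite eqEcard imA card_in_imset; last exact: (can_in_inj (sub_in1 sAZ partnerK)).
  rewrite -(card_imset B (inv_inj swapK)); apply/subset_leq_card/subsetP=> _ /imsetP[w wB ->].
  move: wB; rewrite [_ \in B]in_set [_ \in A]in_set => /andP[wZ /eqP wi].
  by rewrite swap_Z wZ coord_swap wi.
have : v \in B by rewrite in_set vZ vi.
rewrite -eq_B => /imsetP[w wA def_v]; have wZ := sAZ w wA.
have [x xw] := dart_Z wZ; move: def_v; rewrite (partnerP _ _ wZ xw) => def_v.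
have [_ wv] := dart_Z_sym wZ xw; rewrite -def_v in wv.
rewrite (dart_Z_unique vZ wv uv).
by move: wA; rewrite in_set => /andP[_ /eqP].
Qed.

Lemma dart_Z_swap u v : v \in setZ k -> dart u v -> u = swap v.
Proof.
move=> vZ uv; have [uZ vu] := dart_Z_sym vZ uv; apply: cubeP => i; rewrite coord_swap.
have below x y j : x \in setZ k -> dart y x -> coord x j = 2 -> coord y j = 1.
  move=> xZ yx xj; have [z zx] : exists2 z, dart z x & coord x j = (coord z j).+1.
    by apply: needs_dart; rewrite /needs xj.
  by rewrite xj (dart_Z_unique xZ yx zx) => /eq_add_S.
case: eqP => [v1|v_n1]; first exact: (dart_Z_coord1 vZ uv v1).
case: eqP => [v2|v_n2]; first exact: below vZ uv v2.
(* In the remaining case [v] has i-th coordinate 3. Adjacency leaves 2 or 3 for [u], and 2 would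
   force 1 at [v] by [below]. *)
have [_ adj_le _] := E_king; have /andP[vuE _] := vu.
have := adj_le v u vuE i; have := coord_le3 u i; have := coord_le3 v i.
have := coord_gt0 v i; have := below u v i uZ vu; lia.
Qed.

(** Every edge is a dart into X or Z, and its head determines its tail. Conversely, each vertex of X
    or Z has an incoming dart, which must be the prescribed edge. *)
Lemma edges_extremal : E = edgesX k :|: edgesZ k.
Proof.
apply/setP=> e; apply/idP/setUP=> [/edge_dart[u [v [uv ->]]] | [] /imset2P[x y]].
- have /andP[_ /helps_XZ/orP[vX|vZ]] := uv.
    left; apply/imset2P; exists v u => //; last by rewrite setUC.
    by rewrite in_set in_setT; apply/forallP=> i; apply/eqP/dart_X.
  right; have [uZ _] := dart_Z_sym vZ uv; apply/imset2P; exists u v => //.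
  rewrite in_set vZ; apply/forallP=> i.
  rewrite (dart_Z_swap vZ uv) coord_swap.
  have : coord v i = 1 \/ coord v i = 2 \/ coord v i = 3.
    by have := coord_le3 v i; have := coord_gt0 v i; lia.
  by case=> [|[]] ->.
- rewrite !inE => xX /forallP xy ->; have {}xX : x \in setX k by rewrite inE.
  have [u ux] := charge_X k_gt0 xX; have {}ux : dart u x by rewrite -charge_gt0 ux.
  suff <- : u = y by rewrite setUC; case/andP: ux.
  by apply: cubeP => i; have := dart_X xX ux i; rewrite (eqP (xy i)) => /eq_add_S.
move=> xZ; rewrite in_set => /andP[yZ /forallP xy] ->.
have [u ux] := dart_Z xZ; suff <- : u = y by rewrite setUC; case/andP: ux.
rewrite (dart_Z_swap xZ ux); apply: cubeP => i; rewrite coord_swap.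
by case/or3P: (xy i) => /andP[/eqP-> /eqP->].
Qed.

End Extremal.
End KingCovering.

(** * Upper bounds on the number of edges of T_k *)

Lemma edgesZ_pair e : e \in edgesZ k -> exists2 z, z \in setZ k & e = [set z; swap z].
Proof.
case/imset2P=> x y xZ; rewrite in_set => /andP[_ /forallP xy] ->; exists x => //.
congr [set x; _]; apply: cubeP => i; rewrite coord_swap.
by case/or3P: (xy i) => /andP[/eqP-> /eqP->].
Qed.

(** The edges are pairwise disjoint pairs inside Z, since [swap] is an involution without fixed
    points there. *)
Lemma card_edgesZ_le : 2 * #|edgesZ k| <= #|setZ k|.
Proof.
have triv : trivIset (edgesZ k).
  apply/trivIsetP=> _ _ /edgesZ_pair[x _ ->] /edgesZ_pair[y _ ->].
  apply: contraNT => /pred0Pn[z /= /andP[]].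
  rewrite !inE => /orP[]/eqP-> /orP[]/eqP => [->|->|<-|/(inv_inj swapK)->] //.
  - by rewrite swapK setUC.
  - by rewrite swapK setUC.
have /eqP := triv; rewrite /trivIset (eq_bigr (fun _ => 2)).
  rewrite sum_nat_const mulnC => ->; apply/subset_leq_card/subsetP=> v /bigcupP[e].
  by case/edgesZ_pair=> z zZ -> /set2P[]->; rewrite ?swap_Z.
move=> e /edgesZ_pair[z /setZP[[i zi] _] ->]; rewrite cards2.
by case: eqP => // /(congr1 (fun x : cube k => coord x i)); rewrite coord_swap zi.
Qed.

(** The endpoint in X determines the edge: the other end is 1 lower in every coordinate. *)
Lemma card_edgesX_le : #|edgesX k| <= #|setX k|.
Proof.
pose pred v : cube k := [ffun i => inord (v i).-1].
apply: leq_trans (leq_imset_card (fun x => [set x; pred x]) _).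
apply/subset_leq_card/subsetP=> _ /imset2P[x y xX] + ->.
rewrite in_set in_setT => /forallP xy; apply/imsetP; exists x => //.
congr [set x; _]; apply/ffunP=> i; rewrite ffunE.
by have /eqP := xy i; rewrite /coord => -[->] /=; rewrite inord_val.
Qed.

(** * From the class of compositions to king coverings *)

Lemma layer_edges_adj u v i j : [set u; v] \in layer_edges i j j.+1 ->
  forall t, coord u t <= (coord v t).+1.
Proof.
case/imset2P=> x y; rewrite !in_set => /eqP xj /andP[/eqP yj /forall_inP xy] eq_uv t.
have {xy} : coord x t <= (coord y t).+1 /\ coord y t <= (coord x t).+1.
  by have [->|/xy] := eqVneq t i; [rewrite xj yj; lia | lia].
have := set21 u v; have := set22 u v; rewrite eq_uv.
by case/set2P=> -> /set2P[]->; lia.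
Qed.

(** Serves [graphC] with [j = 1] and [graphD] with [j = 2]: a vertex of the upper slab can only be
    covered by an edge from the lower one. *)
Lemma covering_below i j (V : {set cube k}) (G : sgraph V) (S : {set cube k}) E v :
  edges G = layer_edges i j j.+1 -> E \in coverings G S ->
  v \in S -> coord v i = j.+1 ->
  exists2 u, [set u; v] \in E & coord v i = (coord u i).+1.
Proof.
move=> defG; rewrite in_set => /andP[/subsetP sEG /forall_inP cov] vS vi.
have /exists_inP[e eE ve] := cov v vS; have := sEG e eE; rewrite defG.
case/imset2P=> x y; rewrite !in_set => /eqP xj /andP[/eqP yj _] def_e.
have [v_y|v_x] : v = y \/ v = x by move: ve; rewrite def_e => /set2P[]; [right|left].
  by exists x; rewrite v_y -?def_e // xj.
by move: vi; rewrite v_x xj; lia.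
Qed.

(** Edges meeting the [inl] side are not images of edges of the cube, and [inr] is injective. *)
Lemma compose_edges_inj (H H' : sgraph [set: cube k]) :
  compose_edges H = compose_edges H' -> edges H \subset edges H'.
Proof.
move=> eqHH'; apply/subsetP=> e eH.
have : [set inr x | x in e] \in compose_edges H'.
  by rewrite -eqHH' in_setU; apply/orP; left; apply: imset_f.
case/setUP=> [/imsetP[f fH' /imset_inj->] // x y [] //|].
case/imset2P=> i x _ _ /setP/(_ (inl i)); rewrite in_set2 eqxx /=.
by case/imsetP=> ? _.
Qed.

Lemma classC_king_covering (H : sgraph [set: cube k]) :
  classC (compose H) -> king_covering (edges H).
Proof.
case=> E [F [covE covF eqH]]; set U := \bigcup_i _ in eqH.
have /sgraph_eqP/= eq_comp := eqH.
have defH : edges H = [set e in U | #|e| == 2].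
  by apply/eqP; rewrite eqEsubset (compose_edges_inj eq_comp) (compose_edges_inj (esym eq_comp)).
have layerU e : e \in U -> exists i j, e \in layer_edges i j j.+1.
  case/bigcupP=> i _ /setUP[] ei; exists i.
    by exists 1; have := covE i; rewrite in_set => /andP[/subsetP/(_ e ei)].
  by exists 2; have := covF i; rewrite in_set => /andP[/subsetP/(_ e ei)].
have edge2 e : e \in edges H -> #|e| = 2.
  by rewrite defH in_set => /andP[_ /eqP].
have mem_H u v i : [set u; v] \in E i :|: F i -> coord v i = (coord u i).+1 ->
    [set u; v] \in edges H.
  move=> uvi vi; rewrite defH in_set cards2; apply/andP; split.
    by apply/bigcupP; exists i.
  (* The endpoints differ at coordinate [i], so [span] keeps the pair. *)
  by case: (u =P v) => // eq_uv; move: vi; rewrite eq_uv; lia.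
split=> // [u v|v i].
  by rewrite defH in_set => /andP[/layerU[i [j uv]] _]; apply: layer_edges_adj uv.
case/orP=> [/eqP vi|/andP[vX /eqP vi]].
  have [||u uv eq_v] := covering_below _ (covE i) _ vi => //.
    by rewrite in_set vi.
  by exists u => //; apply: mem_H eq_v; rewrite in_setU uv.
have [||u uv eq_v] := covering_below _ (covF i) _ vi => //.
  by rewrite in_set vi; move: vX; rewrite in_set.
by exists u => //; apply: mem_H eq_v; rewrite in_setU uv orbT.
Qed.

End Cube.

Theorem corollary4p20 (k : nat) (hk : 2 <= k) (H2 : sgraph [set: cube k])
    (hmin : kminimal H2) :
  #|edges H2| = (3 ^ k + 1) %/ 2 <-> H2 = graphT k.
Proof.
have k_gt0 : 0 < k by apply: ltnW.
have [/classC_king_covering H_king _] := hmin.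
have even_card : 2 * ((3 ^ k + 1) %/ 2) = 3 ^ k + 1.
  (* [3 ^ k] is odd, so the division by 2 is exact. *)
  by rewrite mulnC divnK // dvdn2 oddD oddX orbT.
split=> [card_H|eqH].
  apply/sgraph_eqP; rewrite edges_graphT //.
  by apply: (edges_extremal H_king k_gt0); rewrite card_H.
(* Conversely, 2|E_X| + 2|E_Z| is at most 2|X| + |Z| = 3^k + 1, which meets the lower bound. *)
have := sum_demand_le H_king k_gt0; rewrite eqH edges_graphT //.
have := card_edgesX_le k; have := card_edgesZ_le k; have := card_setXZ k.
have := subset_leq_card (subsetIl (edgesX k) (edgesZ k)).
rewrite cardsU; lia.
Qed.
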